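(* Let $c_X,c_Y>0$ and $\lambda(t)\in C^2\bigl((0,\infty),[0,\infty)\bigr)$. Let $\{(X(t),Y(t))\}_{t\ge0}$ be the asymmetric standard orthogonal planar random motion with speed $c_X$ along the $x$-axis, speed $c_Y$ along the $y$-axis and rate function $\lambda(t)$. Then the following representation holds in distribution: $$\begin{cases}X(t)=c_X\bigl(U(t)+V(t)\bigr),\\ Y(t)=c_Y\bigl(U(t)-V(t)\bigr),\end{cases}$$ where $\{U(t)\}_{t\ge0}$ and $\{V(t)\}_{t\ge0}$ are two independent one-dimensional telegraph processes with parameters $(1/2,\lambda(t)/2)$.
   Context: Directions: $d_k=(\cos(k\pi/2),\sin(k\pi/2))$, $k=0,1,2,3$, with indices taken modulo 4. The asymmetric standard orthogonal planar random motion is the position $(X(t),Y(t))$ of a particle that starts at the origin at time $0$ with initial direction uniformly distributed on $\{d_0,d_1,d_2,d_3\}$; it moves with velocity $c_X d_k$ while its direction is horizontal ($k=0,2$) and $c_Y d_k$ while its direction is vertical ($k=1,3$); at each event of a non-homogeneous Poisson process with rate function $\lambda(t)$ it switches from its current direction $d_k$ to $d_{k+1}$ or $d_{k-1}$, each with probability $1/2$ (independently of everything else). A one-dimensional (symmetric) telegraph process with parameters $(v,\mu(t))$, i.e. velocity $v>0$ and rate function $\mu(t)$, is the position of a particle on $\mathbb{R}$ starting at $0$ with initial velocity $+v$ or $-v$, each with probability $1/2$, and reversing its velocity at each event of an independent non-homogeneous Poisson process with rate function $\mu(t)$. *)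

(* Defs.v *)
From HB Require Import structures.
From mathcomp Require Import all_boot all_order all_algebra finmap.
From mathcomp Require Import all_classical all_reals all_analysis.

Set Implicit Arguments.
Unset Strict Implicit.
Unset Printing Implicit Defensive.

Import Order.TTheory GRing.Theory Num.Theory.
Import numFieldNormedType.Exports.

Local Open Scope classical_set_scope.
Local Open Scope ring_scope.

(* The discrete sigma-algebra on the nonempty ordinals, hence on 'Z_4. *)
HB.instance Definition _ (n : nat) := isPointed.Build 'I_n.+1 ord0.
HB.instance Definition _ (n : nat) :=
  @isMeasurable.Build default_measure_display 'I_n.+1
    discrete_measurable discrete_measurable0
    discrete_measurableC discrete_measurableU.

Definition C2_on (R : realType) (D : set R) (f : R -> R) : Prop :=
  forall x, D x ->
    [/\ derivable f x 1, derivable f^`()%classic x 1 &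
        {for x, continuous f^`(2)%classic}].

(* Processes are indexed by all of R, but only times in this set matter. *)
Definition nonneg_times (R : realType) : set R := [set t | 0 <= t].

Definition sigma_process (I : Type) (D : set I) (d : measure_display)
    (E : measurableType d) (T : pointedType) (X : I -> T -> E) :
    set_system T :=
  <<s \bigcup_(t in D) g_sigma_algebra_preimage (X t) >>.

Definition mutually_independent (d : measure_display) (T : measurableType d)
    (R : realType) (P : probability T R) (I : choiceType)
    (F : I -> set_system T) : Prop :=
  forall (J : {fset I}) (A : I -> set T),
    (forall i, i \in J -> F i (A i)) ->
    P (\bigcap_(i in [set` J]) A i) = (\prod_(i <- J) P (A i))%E.

Definition independent_pair (d : measure_display) (T : measurableType d)
    (R : realType) (P : probability T R) (F G : set_system T) : Prop :=
  forall A B, F A -> G B -> P (A `&` B) = (P A * P B)%E.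

(* Equality of the laws that two processes, possibly living on different
   probability spaces, induce on the cylinder sigma-algebra of the space of
   E-valued paths over [0, +oo[. *)
Definition same_law (R : realType) (dE : measure_display)
    (E : measurableType dE)
    (d1 : measure_display) (T1 : measurableType d1) (P1 : probability T1 R)
    (X1 : R -> T1 -> E)
    (d2 : measure_display) (T2 : measurableType d2) (P2 : probability T2 R)
    (X2 : R -> T2 -> E) : Prop :=
  forall A : set (R -> E),
    sigma_process (@nonneg_times R) (fun t (x : R -> E) => x t) A ->
    P1 ((fun w t => X1 t w) @^-1` A) = P2 ((fun w t => X2 t w) @^-1` A).

Definition increment (R : realType) (T : Type) (N : R -> T -> nat) (s t : R) :
    T -> nat :=
  fun w => (N t w - N s w)%N.

(* Counting process of the events: N t is the number of events in ]0, t].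
   A rate whose integral near 0 diverges is excluded, since N t is finite.
   The second argument of the library's poisson_prob is a dummy; for parameter
   0 it is the Dirac mass at 0. *)
Definition poisson_process (d : measure_display) (T : measurableType d)
    (R : realType) (P : probability T R) (rate : R -> R)
    (N : R -> {RV P >-> nat}) : Prop :=
  [/\ forall t : R, 0 <= t ->
        lebesgue_measure.-integrable `]0, t] (fun x : R => (rate x)%:E),
      forall w, [/\ N 0 w = 0%N,
        forall s t : R, 0 <= s -> s <= t -> (N s w <= N t w)%N &
        forall t : R, 0 <= t -> \forall s \near t^'+, N s w = N t w],
      forall s t : R, 0 <= s -> s <= t -> forall B : set nat,
        P (increment N s t @^-1` B) =
        poisson_prob (\int[lebesgue_measure]_(x in `]s, t]) rate x)%R 0 B &
      forall t : nat -> R, 0 <= t 0%N -> nondecreasing_seq t ->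
        mutually_independent P (fun i : nat =>
          g_sigma_algebra_preimage (increment N (t i) (t i.+1)))].

Definition telegraph_process (d : measure_display) (T : measurableType d)
    (R : realType) (P : probability T R) (v : R) (rate : R -> R)
    (U : R -> T -> R) : Prop :=
  exists (N : R -> {RV P >-> nat}) (V0 : {RV P >-> R}),
    [/\ poisson_process rate N,
        P (V0 @^-1` [set v]) = (1 / 2)%:E /\
        P (V0 @^-1` [set - v]) = (1 / 2)%:E,
        independent_pair P (sigma_process (@nonneg_times R) N)
          (g_sigma_algebra_preimage V0) &
        forall (t : R) (w : T), 0 <= t ->
          U t w = (\int[lebesgue_measure]_(s in `[0, t])
                     (V0 w * (-1) ^+ N s w))%R].

Section orthogonal_directions.
Context {R : realType}.
Implicit Types k : 'Z_4.

Definition dirX k : R := cos (k%:R * pi / 2).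

Definition dirY k : R := sin (k%:R * pi / 2).

Definition speed (cX cY : R) k : R := if odd k then cY else cX.

(* Direction after n switches; b j tells whether the (j+1)-st switch leads from
   d_i to d_(i+1) or to d_(i-1). *)
Definition direction (k0 : 'Z_4) (b : nat -> bool) (n : nat) : 'Z_4 :=
  k0 + \sum_(j < n) (if b j then 1 else - 1).

End orthogonal_directions.

Definition orthogonal_motion (d : measure_display) (T : measurableType d)
    (R : realType) (P : probability T R) (cX cY : R) (rate : R -> R)
    (X Y : R -> T -> R) : Prop :=
  exists (N : R -> {RV P >-> nat}) (K0 : {RV P >-> 'Z_4})
      (S : nat -> {RV P >-> bool}),
    let D t w := direction (K0 w) (fun j => S j w) (N t w) in
    [/\ poisson_process rate N,
        forall k : 'Z_4, P (K0 @^-1` [set k]) = (1 / 4)%:E,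
        forall j (b : bool), P (S j @^-1` [set b]) = (1 / 2)%:E,
        mutually_independent P (fun i : nat =>
          match i with
          | 0 => sigma_process (@nonneg_times R) N
          | 1 => g_sigma_algebra_preimage K0
          | j.+2 => g_sigma_algebra_preimage (S j)
          end) &
        forall (t : R) (w : T), 0 <= t ->
          X t w = (\int[lebesgue_measure]_(s in `[0, t])
                     (speed cX cY (D s w) * dirX (D s w)))%R /\
          Y t w = (\int[lebesgue_measure]_(s in `[0, t])
                     (speed cX cY (D s w) * dirY (D s w)))%R].

(* Main.v *)
Require Import Defs.
From HB Require Import structures.
From mathcomp Require Import all_boot all_order all_algebra finmap.
From mathcomp Require Import all_classical all_reals all_analysis.
From mathcomp Require Import measurable_realfun ring zify.

Set Implicit Arguments.
Unset Strict Implicit.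
Unset Printing Implicit Defensive.

Import Order.TTheory GRing.Theory Num.Theory.
Import numFieldNormedType.Exports.

Local Open Scope classical_set_scope.
Local Open Scope ring_scope.

(** In the rotated coordinates U = (X / cX + Y / cY) / 2 and
    V = (X / cX - Y / cY) / 2 the four directions d_k become the four pairs of
    signs (+,+), (+,-), (-,-), (-,+), and U and V each have speed 1/2. A switch
    to a neighbouring direction reverses exactly one of the two signs, and the
    fair coin that chooses between d_(k+1) and d_(k-1) chooses which one
    ([signU_turn], [signV_turn]). So the coins thin the Poisson process of
    switches into two counting processes, those of the reversals of U and of V,
    and thinning a Poisson process by fair coins produces two independent
    Poisson processes with half the rate; the two initial signs are independent
    and fair as well. Hence U and V are independent telegraph processes.

    The proof compares finite-dimensional laws. On the times k / 2^n,
    k <= n 2^n, [motion_skeletonP] computes the joint law of the two counts and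
    the two initial signs: given the total number of switches in each dyadic
    interval, the coins contribute a binomial coefficient per interval
    ([card_block_tuples]), and a Poisson weight times a binomial weight factors
    into two Poisson weights ([poisson_weight_thinning]). The law of one
    telegraph process on the same grid is [telegraph_skeletonP].

    These grid events form a pi-system, because the dyadic grids are nested, so
    the laws of the whole signed counting paths agree ([joint_counts_law]).
    Positions are measurable functions of those paths, since the integral of a
    right-continuous step function is a limit of Riemann sums over dyadic
    points ([integral_right_step]). The hypothesis on the pair of telegraph
    processes gives independence of the positions but not of the underlying
    counting processes and signs; therefore the comparison is made with the
    product of the second probability space with itself, one factor for each
    telegraph process, and independence of the positions identifies the
    probabilities of rectangles there with those on the original space
    ([rectangle_law]). *)

(** * Laws determined on a pi-system *)

Lemma pi_system_law_eq (R : realType) (d1 d2 : measure_display)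
  (T1 : measurableType d1) (T2 : measurableType d2) (Om : Type)
  (P1 : probability T1 R) (P2 : probability T2 R)
  (Z1 : T1 -> Om) (Z2 : T2 -> Om) (G : set_system Om) :
  setI_closed G ->
  (forall A, G A -> [/\ measurable (Z1 @^-1` A), measurable (Z2 @^-1` A) &
     P1 (Z1 @^-1` A) = P2 (Z2 @^-1` A)]) ->
  forall A, <<s G >> A -> [/\ measurable (Z1 @^-1` A),
     measurable (Z2 @^-1` A) & P1 (Z1 @^-1` A) = P2 (Z2 @^-1` A)].
Proof.
move=> GI GP; pose H := [set A | [/\ measurable (Z1 @^-1` A),
  measurable (Z2 @^-1` A) & P1 (Z1 @^-1` A) = P2 (Z2 @^-1` A)]].
suff : <<s G >> `<=` H by [].
apply: lambda_system_subset => //.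
apply/dynkin_lambda_system; split.
- split; [exact: measurableT|exact: measurableT|].
  by rewrite !preimage_setT !probability_setT.
- move=> A [m1 m2 e]; split; rewrite -!preimage_setC;
  [exact: measurableC|exact: measurableC|by rewrite !probability_setC// e].
- move=> F tF HF.
  have m1 k : measurable (Z1 @^-1` F k) by have [] := HF k.
  have m2 k : measurable (Z2 @^-1` F k) by have [] := HF k.
  have tZ (T : Type) (Z : T -> Om) : trivIset setT (fun k => Z @^-1` F k).
    apply/trivIsetP => i j _ _ ij; rewrite -preimage_setI.
    by move/trivIsetP : tF => ->//; rewrite preimage_set0.
  split; rewrite !preimage_bigcup;
    [exact: bigcupT_measurable|exact: bigcupT_measurable|].
  rewrite !measure_bigcup//.
  by apply: eq_eseriesr => k _; have [] := HF k.
Qed.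

Lemma sigma_process_preimage (I : Type) (D : set I) (d d' : measure_display)
  (E : measurableType d) (S : measurableType d') (phi : S -> I -> E) :
  (forall t, D t -> measurable_fun setT (phi^~ t)) ->
  forall A, sigma_process D (fun t (x : I -> E) => x t) A ->
  measurable (phi @^-1` A).
Proof.
move=> mphi.
suff : sigma_process D (fun t (x : I -> E) => x t) `<=`
  [set A | measurable (phi @^-1` A)] by [].
apply: smallest_sub.
  split => /=; first by rewrite preimage_set0.
  - by move=> A mA; rewrite setTD -preimage_setC; exact: measurableC.
  - by move=> F mF; rewrite preimage_bigcup; exact: bigcupT_measurable.
move=> _ [t Dt] [B mB <-] /=; rewrite setTI.
by have := mphi t Dt measurableT B mB; rewrite setTI.
Qed.

(** A set in the sigma-algebra of the coordinates of [D] cannot see the others: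
    the sets with this property form a sigma-algebra. Here it disposes of the
    values that processes take at negative times. *)
Lemma sigma_process_eq (I : Type) (D : set I) (d : measure_display)
  (E : measurableType d) (A : set (I -> E)) (x y : I -> E) :
  sigma_process D (fun t (x : I -> E) => x t) A ->
  (forall t, D t -> x t = y t) -> A x = A y.
Proof.
move=> sA xy.
suff : sigma_process D (fun t (x : I -> E) => x t) `<=` [set A | A x = A y].
  by exact.
apply: smallest_sub.
  split => //=.
  - by move=> B /= e; rewrite /setD/= e.
  - by move=> F /= e; apply: propext; split => -[n _ h]; exists n => //;
    move: h; rewrite e.
by move=> _ [t Dt] [B mB <-] /=; rewrite /setI /preimage /= xy.
Qed.

(** * Integrals of step paths as limits over dyadic grids *)

Definition dyadic (R : realType) (n k : nat) : R := k%:R / 2 ^+ n.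

Lemma dyadic_ge0 (R : realType) n k : 0 <= dyadic R n k.
Proof. by rewrite divr_ge0// exprn_ge0. Qed.

Lemma dyadic0 (R : realType) n : dyadic R n 0 = 0.
Proof. by rewrite /dyadic mul0r. Qed.

Lemma dyadic_refine (R : realType) n m k :
  dyadic R (n + m) (k * 2 ^ m) = dyadic R n k.
Proof.
rewrite /dyadic natrM natrX exprD invfM mulrACA.
by rewrite divff ?mulr1// expf_neq0.
Qed.

Lemma dyadic_le (R : realType) n k l :
  (k <= l)%N -> dyadic R n k <= dyadic R n l.
Proof. by move=> kl; rewrite ler_pM2r ?ler_nat// invr_gt0 exprn_gt0. Qed.

Definition right_step (R : realType) (E : Type) (f : R -> E) : Prop :=
  forall s, 0 <= s -> \forall u \near s^'+, f s = f u.

Definition dyadic_cell (R : realType) (n k : nat) : set R :=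
  `[dyadic R n k, dyadic R n k.+1[%classic.

Definition cell_weight (R : realType) (t : R) (n k : nat) : R :=
  fine (lebesgue_measure (dyadic_cell n k `&` `[0, t])).

Definition cell_count (R : realType) (t : R) (n : nat) : nat :=
  (Num.truncn (t * 2 ^+ n)).+1.

(** Right endpoints are used because the integrands are right-continuous. The
    last cell may stick out of [0, t], so a value of [f] after time [t] can
    occur in the sum. *)
Definition riemann (R : realType) (f : R -> R) (t : R) (n : nat) : R :=
  \sum_(k < cell_count t n) f (dyadic R n k.+1) * cell_weight t n k.

(** An upper limit, so that it is defined for every [f] and measurable in [f]
    for the sigma-algebra of the values of [f] at dyadic points. *)
Definition riemann_lim (R : realType) (f : R -> R) (t : R) : R :=
  fine (limn_esup (fun n => (riemann f t n)%:E)).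

Definition step_approx (R : realType) (f : R -> R) (t : R) (n : nat) (s : R)
  : R :=
  \sum_(k < cell_count t n) f (dyadic R n k.+1) * \1_(dyadic_cell n k) s.

Lemma mem_dyadic_cell (R : realType) (n k : nat) (s : R) : 0 <= s ->
  (s \in dyadic_cell n k) = (Num.truncn (s * 2 ^+ n) == k).
Proof.
move=> s0; rewrite truncn_eq ?mulr_ge0 ?exprn_ge0//.
rewrite /dyadic_cell /dyadic mem_setE.
by rewrite in_itv/= ler_pdivrMr ?exprn_gt0// ltr_pdivlMr ?exprn_gt0.
Qed.

Lemma step_approxE (R : realType) (f : R -> R) (t s : R) n : 0 <= s <= t ->
  step_approx f t n s = f (dyadic R n (Num.truncn (s * 2 ^+ n)).+1).
Proof.
move=> /andP[s0 st]; rewrite /step_approx.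
have lt : (Num.truncn (s * 2 ^+ n) < cell_count t n)%N.
  by rewrite ltnS le_truncn// ler_pM2r ?exprn_gt0.
rewrite (bigD1 (Ordinal lt))//= big1 ?addr0.
  by rewrite indicE mem_dyadic_cell// eqxx mulr1.
move=> i /negbTE ni; rewrite indicE mem_dyadic_cell//.
by rewrite -val_eqE /= in ni; rewrite eq_sym ni mulr0.
Qed.

(** The right endpoints of the cells that contain [s] lie strictly to the right
    of [s] and tend to [s], and [f] equals [f s] on a right neighbourhood. *)
Lemma step_approx_cvg (R : realType) (f : R -> R) (t s : R) :
  right_step f -> 0 <= s <= t ->
  (step_approx f t n s)%:E @[n --> \oo] --> (f s)%:E.
Proof.
move=> rf st; have /andP[s0 _] := st.
apply: cvg_near_cst; have := rf _ s0.
rewrite /at_right/within/= => -[/= e e0 He].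
have := near_infty_natSinv_expn_lt (PosNum e0).
case=> N _ HN; exists N => // n /= Nn.
rewrite step_approxE//; congr (_%:E); apply/esym.
have p0 : 0 < 2 ^+ n :> R by rewrite exprn_gt0.
have /andP[h1 h2] := truncn_itv (mulr_ge0 s0 (ltW p0)).
apply: He => /=; last by rewrite /dyadic ltr_pdivlMr.
rewrite /dyadic distrC ger0_norm; last first.
  by rewrite subr_ge0 ler_pdivlMr// ltW.
apply: le_lt_trans (HN n Nn) => /=.
rewrite lerBlDr ler_pdivrMr// mulrDl mulfVK ?gt_eqF// -natr1.
by rewrite addrC lerD2l.
Qed.

Lemma measurable_step_approx (R : realType) (f : R -> R) (t : R) n D :
  measurable_fun D (step_approx f t n).
Proof.
apply: measurable_sum => k; apply: measurable_funM => //.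
by apply: measurable_indic; exact: measurable_itv.
Qed.

Lemma measurable_right_step (R : realType) (f : R -> R) (t : R) :
  right_step f -> measurable_fun `[0, t] f.
Proof.
move=> rf; apply/measurable_EFinP.
apply: (emeasurable_fun_cvg (fun n => EFin \o step_approx f t n)).
  by move=> n; apply/measurable_EFinP; exact: measurable_step_approx.
move=> s /=; rewrite in_itv/= => st; exact: step_approx_cvg.
Qed.

Lemma integral_step_approx (R : realType) (f : R -> R) (t : R) n :
  (\int[lebesgue_measure]_(s in `[0%R, t]) (step_approx f t n s)%:E =
  (riemann f t n)%:E)%E.
Proof.
have mt : measurable `[0%R, t] by exact: measurable_itv.
have fin (A : set R) : measurable A ->
    (lebesgue_measure (A `&` `[0%R, t]) < +oo)%E.
  move=> mA; apply: (@le_lt_trans _ _ (lebesgue_measure `[0%R, t])).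
    by rewrite le_measure ?inE//; exact: measurableI.
  by rewrite /= lebesgue_measure_itv/=; case: ifP => _; rewrite ltry.
have mc k : measurable (dyadic_cell n k) by exact: measurable_itv.
have ii k : lebesgue_measure.-integrable `[0%R, t]
    (fun s : R => (\1_(dyadic_cell n k) s)%:E).
  by apply: (@integrableS _ _ _ _ setT) => //; exact: integrable_indic_itv.
under eq_integral do rewrite /step_approx -sumEFin.
rewrite integral_sum//; last first.
  by move=> k; apply: (integrableZl _ _ (ii k)).
rewrite /riemann -sumEFin; apply: eq_bigr => k _.
under eq_integral do rewrite EFinM.
rewrite (integralZl _ (ii k)); last exact: measurable_itv.
rewrite integral_indic; [|exact: measurable_itv|exact: measurable_itv].
rewrite [RHS]EFinM /cell_weight fineK ?ge0_fin_numE //; last by apply: fin.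
Qed.

(** Dominated convergence along [step_approx], whose integrals are the sums
    [riemann]. *)
Lemma integral_right_step (R : realType) (f : R -> R) (M t : R) :
  right_step f -> (forall s, `|f s| <= M) ->
  lebesgue_measure.-integrable `[0%R, t] (EFin \o f) /\
  \int[lebesgue_measure]_(s in `[0%R, t]) f s = riemann_lim f t.
Proof.
move=> rf fM; have mt : measurable `[0%R, t] by exact: measurable_itv.
have mM : lebesgue_measure.-integrable `[0%R, t] (EFin \o cst M).
  apply: measurable_bounded_integrable => //; last exact: bounded_cst.
  by rewrite /= lebesgue_measure_itv/=; case: ifP => _; rewrite ltry.
have [] := @dominated_convergence _ _ _ lebesgue_measure `[0, t] mt
  (fun n => EFin \o step_approx f t n) (EFin \o f) (EFin \o cst M).
- by move=> n; apply/measurable_EFinP; exact: measurable_step_approx.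
- by apply/measurable_EFinP; exact: measurable_right_step.
- by apply: aeW => s /=; rewrite in_itv/= => st; exact: step_approx_cvg.
- exact: mM.
- apply: aeW => s n /=; rewrite in_itv/= => st.
  by rewrite lee_fin step_approxE.
move=> intf _ cvgf; split; first exact: intf.
rewrite /Rintegral /riemann_lim; congr fine.
have -> : (fun n => (riemann f t n)%:E) = (fun n =>
    \int[lebesgue_measure]_(s in `[0%R, t]) (step_approx f t n s)%:E)%E.
  by apply/funext => n; rewrite integral_step_approx.
rewrite limn_esup_lim; apply/esym/cvg_lim => //.
exact: cvg_esups.
Qed.

(** * Bit strings with prescribed block counts *)

Definition counting_path (M : nat) (l : nat -> nat) : Prop :=
  l 0%N = 0%N /\ forall k, (k < M)%N -> (l k <= l k.+1)%N.

Lemma eq_counting_path (M : nat) (l l' : nat -> nat) :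
  (forall k, (k <= M)%N -> l k = l' k) -> counting_path M l' ->
  counting_path M l.
Proof.
by move=> e [l0 lM]; split=> [|k kM]; rewrite !e ?lM// ltnW.
Qed.

Lemma leq_counting_path (M : nat) (l : nat -> nat) k :
  counting_path M l -> (k <= M)%N -> (l k <= l M)%N.
Proof.
move=> [_]; elim: M => [|M IH] lM; first by rewrite leqn0 => /eqP ->.
rewrite leq_eqVlt => /orP[/eqP-> //|]; rewrite ltnS => kM.
apply: leq_trans (lM M (leqnn _)); apply: IH kM => j jM.
by apply: lM; rewrite ltnW.
Qed.

Lemma counting_pathW (M : nat) (l : nat -> nat) :
  counting_path M.+1 l -> counting_path M l.
Proof. by move=> [l0 lM]; split=> // k kM; apply: lM; rewrite ltnW. Qed.

Lemma counting_pathD (M : nat) (a b : nat -> nat) :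
  counting_path M a -> counting_path M b ->
  counting_path M (fun k => (a k + b k)%N).
Proof.
move=> [a0 aM] [b0 bM]; split=> [|k kM]; first by rewrite a0 b0.
by rewrite leq_add ?aM ?bM.
Qed.

Lemma card_tuple_count (d c : nat) :
  #|[set g : d.-tuple bool | count id g == c]%SET| = 'C(d, c).
Proof.
pose f (g : d.-tuple bool) : {set 'I_d} := [set i | tnth g i]%SET.
pose f' (A : {set 'I_d}) : d.-tuple bool := [tuple i \in A | i < d].
have bf : bijective f.
  exists f' => [g|A]; last by apply/setP => i; rewrite inE tnth_mktuple.
  by apply: eq_from_tnth => i; rewrite tnth_mktuple inE.
rewrite -[in RHS](card_ord d) -(card_draws 'I_d c).
rewrite -(on_card_preimset (f := f)); last exact: onW_bij.
apply: eq_card => g; rewrite !inE; congr (_ == _).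
rewrite -sum1_count big_tuple sum1_card.
by apply: eq_card => i; rewrite inE.
Qed.

Definition block_tuples (l a : nat -> nat) (M L : nat) :=
  [set f : L.-tuple bool |
    [forall k : 'I_M.+1, count id (take (l k) f) == a k]]%SET.

(** The constraints fix the number of bits that are set in each block between
    [l k] and [l k.+1]; blocks are independent, so cutting off the last one
    gives a bijection with pairs and an induction on the number of blocks. *)
Lemma card_block_tuples (l a : nat -> nat) (M L : nat) : L = l M ->
  counting_path M l -> counting_path M a ->
  #|block_tuples l a M L| =
    (\prod_(k < M) 'C(l k.+1 - l k, a k.+1 - a k))%N.
Proof.
elim: M L => [|M IH] L LE lP aP.
  have [[l0 _] [a0 _]] := (lP, aP); rewrite big_ord0; rewrite {}LE l0.
  rewrite -[RHS](card_tuple 0 bool); apply: eq_card => f; rewrite !inE.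
  by apply/forallP => k; rewrite [k]ord1 l0 a0 take0.
have lM : (l M <= l M.+1)%N by have [_] := lP; apply.
have aM : (a M <= a M.+1)%N by have [_] := aP; apply.
have lD : l M.+1 = (l M + (l M.+1 - l M))%N by rewrite subnKC.
rewrite big_ord_recr/= -(IH (l M))//; [|exact: counting_pathW..].
rewrite -card_tuple_count; set d := (l M.+1 - l M)%N in lD *.
have lmono k : (k <= M)%N -> (l k <= l M)%N.
  exact: leq_counting_path (counting_pathW lP).
rewrite {L}LE lD -cardsX.
pose h (p : (l M).-tuple bool * d.-tuple bool) := cat_tuple p.1 p.2.
have hinj : injective h.
  move=> [x y] [x' y'] /(congr1 val) /= /eqP.
  rewrite eqseq_cat ?size_tuple// => /andP[/eqP xx' /eqP yy'].
  by congr pair; apply: val_inj.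
rewrite -(card_imset _ hinj); apply: eq_card => f.
have hT k (x : (l M).-tuple bool) (y : d.-tuple bool) : (k <= M)%N ->
    take (l k) (x ++ y) = take (l k) x.
  by move=> kM; rewrite takel_cat// size_tuple lmono.
have hc (x : (l M).-tuple bool) (y : d.-tuple bool) :
    take (l M.+1) (x ++ y) = x ++ y.
  by rewrite take_oversize// size_cat !size_tuple -lD.
apply/idP/imsetP => [|[[x y]]].
  rewrite inE => /forallP fP.
  have sx : size (take (l M) f) == l M.
    by rewrite size_takel// size_tuple leq_addr.
  have sy : size (drop (l M) f) == d by rewrite size_drop size_tuple addKn.
  have fE : f = h (Tuple sx, Tuple sy).
    by apply: val_inj; rewrite /= cat_take_drop.
  move: (Tuple sx) (Tuple sy) fE => x y fE {sx sy}; subst f.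
  exists (x, y) => //.
  have xM k : (k <= M)%N -> count id (take (l k) x) == a k.
    move=> kM; have /= := fP (widen_ord (leqnSn _) (Ordinal (kM : k < M.+1)%N)).
    by rewrite hT.
  rewrite inE; apply/andP; split; rewrite inE.
    by apply/forallP => k; apply: xM; rewrite -ltnS.
  have /= := fP ord_max; rewrite hc count_cat => /eqP <-.
  have := xM M (leqnn _); rewrite take_oversize ?size_tuple// => /eqP <-.
  by rewrite addKn.
rewrite !inE/= => /andP[/forallP xP /eqP yP] ->.
have xM k : (k <= M)%N -> count id (take (l k) x) == a k.
  by move=> kM; have := xP (Ordinal (kM : k < M.+1)%N).
apply/forallP => k; have [kM|] := leqP k M; first by rewrite hT// xM.
move=> Mk; have -> : (k : nat) = M.+1.
  by apply/eqP; rewrite eqn_leq Mk -ltnS ltn_ord.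
have := xM M (leqnn _); rewrite take_oversize ?size_tuple// => /eqP xc.
by rewrite hc count_cat xc yP subnKC.
Qed.

(** * A Poisson process on a dyadic grid *)

(** The mass function [poisson_pmf] takes the value 1 everywhere at rate 0;
    this formula gives the Dirac mass at 0 there, because 0 ^+ 0 = 1. *)
Definition poisson_weight (R : realType) (r : R) (k : nat) : R :=
  r ^+ k / k`!%:R * expR (- r).

Lemma poisson_prob_set1 (R : realType) (r : R) k : 0 <= r ->
  poisson_prob r 0 [set k] = (poisson_weight r k)%:E.
Proof.
rewrite le_eqVlt => /orP[/eqP <-|r0]; rewrite /poisson_prob /poisson_weight.
  rewrite ltxx oppr0 expR0 mulr1 diracE expr0n.
  have -> : (0%N \in [set k]) = (k == 0)%N by rewrite in_set1 eq_sym.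
  by case: k => [|k]; rewrite ?mul0r// fact0 divr1.
by rewrite r0 esum_set1 ?lee_fin ?poisson_pmf_ge0// /poisson_pmf r0.
Qed.

(** A Poisson number of fair coins has independent Poisson numbers of heads and
    tails, each with half the mean. *)
Lemma poisson_weight_thinning (R : realType) (r : R) a b :
  poisson_weight r (a + b) * ('C(a + b, a)%:R / 2 ^+ (a + b)) =
  poisson_weight (r / 2) a * poisson_weight (r / 2) b.
Proof.
have expE : expR (- r) = expR (- (r / 2)) * expR (- (r / 2)) :> R.
  by rewrite -expRD -opprD -splitr.
have fact_neq0 n : n`!%:R != 0 :> R by rewrite pnatr_eq0 -lt0n fact_gt0.
have C : (a + b)`!%:R = 'C(a + b, a)%:R * a`!%:R * b`!%:R :> R.
  by rewrite -mulrA -!natrM -(bin_fact (leq_addr b a)) addKn mulnA.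
have C0 : 'C(a + b, a)%:R != 0 :> R by rewrite pnatr_eq0 -lt0n bin_gt0 leq_addr.
rewrite /poisson_weight expE C !expr_div_n !exprD; field.
by rewrite !fact_neq0 ?C0 ?expf_neq0.
Qed.

Definition skeleton (R : realType) (T : Type) (N : R -> T -> nat)
    (n M : nat) (l : nat -> nat) : set T :=
  [set w | forall k, (k <= M)%N -> N (dyadic R n k) w = l k].

Lemma skeletonE (R : realType) (T : Type) (N : R -> T -> nat) n M l :
  skeleton N n M l = \bigcap_(k in [set k | (k <= M)%N])
    (N (dyadic R n k) @^-1` [set l k]).
Proof. by apply/seteqP; split => w. Qed.

Lemma measurable_skeleton (R : realType) (d : measure_display)
  (T : measurableType d) (P : probability T R) (N : R -> {RV P >-> nat}) n M l :
  measurable (skeleton N n M l).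
Proof.
rewrite skeletonE; apply: bigcap_measurableType => k _.
by rewrite -[X in measurable X]setTI; exact: measurable_funP.
Qed.

Lemma sigma_process_skeleton (R : realType) (d : measure_display)
  (T : measurableType d) (P : probability T R) (N : R -> {RV P >-> nat}) n M l :
  sigma_process (@nonneg_times R) N (skeleton N n M l).
Proof.
pose G := \bigcup_(t in @nonneg_times R) g_sigma_algebra_preimage (N t).
suff : measurable (skeleton N n M l : set (g_sigma_algebraType G)) by [].
rewrite skeletonE; apply: bigcap_measurableType => k _.
apply: sub_sigma_algebra.
exists (dyadic R n k); first exact: dyadic_ge0.
by exists [set l k] => //; rewrite setTI.
Qed.

Lemma prod_iota_fset (R : realType) (F : nat -> \bar R) M :
  (\prod_(i <- [fset x in iota 0 M]%fset) F i = \prod_(i < M) F i)%E.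
Proof.
rewrite -(big_mkord xpredT F) /index_iota subn0; apply: perm_big.
apply: uniq_perm; rewrite ?iota_uniq ?fset_uniq// => i.
by rewrite in_fset.
Qed.

Definition dyadic_intensity (R : realType) (rate : R -> R) (n k : nat) : R :=
  \int[lebesgue_measure]_(x in `]dyadic R n k, dyadic R n k.+1]) rate x.

Lemma dyadic_intensity_ge0 (R : realType) (rate : R -> R) n k :
  (forall t, 0 < t -> 0 <= rate t) -> 0 <= dyadic_intensity rate n k.
Proof.
move=> r0; apply: Rintegral_ge0 => x /=; rewrite in_itv/= => /andP[h _].
by apply: r0; apply: le_lt_trans h; exact: dyadic_ge0.
Qed.

(** As the process starts at 0, its values on the grid and its increments
    between consecutive grid points determine each other. *)
Lemma poisson_skeleton (R : realType) (d : measure_display)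
  (T : measurableType d) (P : probability T R) (rate : R -> R)
  (N : R -> {RV P >-> nat}) n M l :
  poisson_process rate N -> (forall t, 0 < t -> 0 <= rate t) ->
  counting_path M l ->
  P (skeleton N n M l) =
    (\prod_(k < M) poisson_weight (dyadic_intensity rate n k) (l k.+1 - l k))%:E.
Proof.
move=> [_ Npath Nincr Nind] r0 [l0 lM].
pose t := dyadic R n.
have tle k : t k <= t k.+1 by exact: dyadic_le.
pose A (k : nat) := increment N (t k) (t k.+1) @^-1` [set (l k.+1 - l k)%N].
have -> : skeleton N n M l = \bigcap_(i in [set` [fset x in iota 0 M]%fset]) A i.
  apply/seteqP; split => w /= Nl.
    move=> i /=; rewrite !inE/= mem_iota add0n => iM.
    by rewrite /A/increment/preimage/= !Nl ?(ltnW iM).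
  elim=> [|k IH] kM; first by rewrite dyadic0 l0; have [] := Npath w.
  have [_ mono _] := Npath w.
  have := Nl k; rewrite /= !inE/= mem_iota add0n => /(_ kM).
  rewrite /A/increment/preimage/= -/(t k) -/(t k.+1) => h.
  rewrite -(subnKC (mono _ _ (dyadic_ge0 R n k) (tle k))) h.
  by rewrite (IH (ltnW kM)) subnKC// lM.
have t0 : 0 <= t 0%N by exact: dyadic_ge0.
have tmono : nondecreasing_seq t by move=> i j ij; exact: dyadic_le.
rewrite (Nind t t0 tmono _ A); last first.
  by move=> i _; exists [set (l i.+1 - l i)%N] => //; rewrite setTI.
rewrite prod_iota_fset -prodEFin; apply: eq_bigr => k _.
rewrite Nincr ?dyadic_ge0// poisson_prob_set1//.
exact: dyadic_intensity_ge0.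
Qed.

(** * The four directions as pairs of signs *)

(** Twice the velocities of the two rotated coordinates. *)
Definition signU (R : realType) (k : 'Z_4) : R := dirX k + dirY k.
Definition signV (R : realType) (k : 'Z_4) : R := dirX k - dirY k.

(** Directions by index; the value of [Z4 n] computes to n modulo 4. *)
Definition Z4 (n : nat) : 'Z_4 := inZp n.

Lemma Z4_case (Q : 'Z_4 -> Prop) :
  Q (Z4 0) -> Q (Z4 1) -> Q (Z4 2) -> Q (Z4 3) -> forall k, Q k.
Proof.
move=> h0 h1 h2 h3 [m lm].
have -> : Ordinal lm = Z4 m by apply: val_inj; rewrite /= modn_small.
by move: m lm => [|[|[|[|]]]].
Qed.

Lemma dirX_val (R : realType) : [/\ dirX (Z4 0) = 1 :> R, dirX (Z4 1) = 0 :> R,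
  dirX (Z4 2) = -1 :> R & dirX (Z4 3) = 0 :> R].
Proof.
rewrite /dirX /=; split.
- by rewrite !mul0r cos0.
- by rewrite mul1r cos_pihalf.
- by rewrite mulrC mulKf ?cospi// pnatr_eq0.
- have -> : 3%:R * pi / 2 = pi / 2 + pi :> R by field.
  by rewrite cosDpi cos_pihalf oppr0.
Qed.

Lemma dirY_val (R : realType) : [/\ dirY (Z4 0) = 0 :> R, dirY (Z4 1) = 1 :> R,
  dirY (Z4 2) = 0 :> R & dirY (Z4 3) = -1 :> R].
Proof.
rewrite /dirY /=; split.
- by rewrite !mul0r sin0.
- by rewrite mul1r sin_pihalf.
- by rewrite mulrC mulKf ?sinpi// pnatr_eq0.
- have -> : 3%:R * pi / 2 = pi / 2 + pi :> R by field.
  by rewrite sinDpi sin_pihalf.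
Qed.

Lemma signU_val (R : realType) : [/\ signU R (Z4 0) = 1, signU R (Z4 1) = 1,
  signU R (Z4 2) = -1 & signU R (Z4 3) = -1].
Proof.
by rewrite /signU; have [-> -> -> ->] := dirX_val R;
  have [-> -> -> ->] := dirY_val R; rewrite !addr0 !add0r.
Qed.

Lemma signV_val (R : realType) : [/\ signV R (Z4 0) = 1, signV R (Z4 1) = -1,
  signV R (Z4 2) = -1 & signV R (Z4 3) = 1].
Proof.
by rewrite /signV; have [-> -> -> ->] := dirX_val R;
  have [-> -> -> ->] := dirY_val R; rewrite !subr0 !sub0r opprK.
Qed.

Lemma speed_dirX (R : realType) (cX cY : R) k :
  speed cX cY k * dirX k = cX * ((signU R k + signV R k) / 2).
Proof.
have -> : (signU R k + signV R k) / 2 = dirX k by rewrite /signU /signV; field.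
rewrite /speed; case: ifP => // ko.
suff -> : dirX k = 0 :> R by rewrite !mulr0.
by have [? h1 ? h3] := dirX_val R; move: k ko; apply: Z4_case.
Qed.

Lemma speed_dirY (R : realType) (cX cY : R) k :
  speed cX cY k * dirY k = cY * ((signU R k - signV R k) / 2).
Proof.
have -> : (signU R k - signV R k) / 2 = dirY k by rewrite /signU /signV; field.
rewrite /speed; case: ifP => // ko.
suff -> : dirY k = 0 :> R by rewrite !mulr0.
by have [h0 ? h2 ?] := dirY_val R; move: k ko; apply: Z4_case.
Qed.

Definition turn (b : bool) : 'Z_4 := if b then 1 else - 1.

Lemma turn_val b : [/\ Z4 0 + turn b = if b then Z4 1 else Z4 3,
  Z4 1 + turn b = if b then Z4 2 else Z4 0,
  Z4 2 + turn b = if b then Z4 3 else Z4 1 &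
  Z4 3 + turn b = if b then Z4 0 else Z4 2].
Proof. by case: b; split; apply: val_inj. Qed.

Lemma odd_turn (k : 'Z_4) b : odd (k + turn b)%R = ~~ odd k.
Proof.
by have [h0 h1 h2 h3] := turn_val b; move: k; apply: Z4_case;
  rewrite ?h0 ?h1 ?h2 ?h3; case: b {h0 h1 h2 h3}.
Qed.

(** Together with [signV_turn]: from an even (horizontal) direction a left turn
    reverses the sign of V and a right turn that of U, from an odd one it is the
    other way around. Exactly one of the two signs changes each time. *)
Lemma signU_turn (R : realType) (k : 'Z_4) b :
  signU R (k + turn b) = signU R k * (-1) ^+ (b == odd k).
Proof.
have [h0 h1 h2 h3] := turn_val b; have [a0 a1 a2 a3] := signU_val R.
by move: k; apply: Z4_case; rewrite ?h0 ?h1 ?h2 ?h3; case: b {h0 h1 h2 h3};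
  rewrite ?(a0, a1, a2, a3) /= ?expr0 ?expr1 ?mulr1 ?mulrN1 ?opprK.
Qed.

Lemma signV_turn (R : realType) (k : 'Z_4) b :
  signV R (k + turn b) = signV R k * (-1) ^+ (b != odd k).
Proof.
have [h0 h1 h2 h3] := turn_val b; have [a0 a1 a2 a3] := signV_val R.
by move: k; apply: Z4_case; rewrite ?h0 ?h1 ?h2 ?h3; case: b {h0 h1 h2 h3};
  rewrite ?(a0, a1, a2, a3) /= ?expr0 ?expr1 ?mulr1 ?mulrN1 ?opprK.
Qed.

Lemma directionS (k0 : 'Z_4) b n :
  direction k0 b n.+1 = direction k0 b n + turn (b n).
Proof. by rewrite /direction big_ord_recr/= addrA. Qed.

Lemma odd_direction (k0 : 'Z_4) b n :
  odd (direction k0 b n) = odd k0 (+) odd n.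
Proof.
elim: n => [|n IH]; first by rewrite /direction big_ord0 addr0 addbF.
by rewrite directionS odd_turn IH /= addbN.
Qed.

(** Whether the (j+1)-st switch reverses the sign of U. The direction before it has the
    parity of [k0 + j] whatever the earlier coins, since every switch changes
    the parity; this is why the bits [flip k0 b j] are again independent fair
    coins when the [b j] are. *)
Definition flip (k0 : 'Z_4) (b : nat -> bool) (j : nat) : bool :=
  b j == odd k0 (+) odd j.

Definition flips (k0 : 'Z_4) (b : nat -> bool) (n : nat) : nat :=
  count id (mkseq (flip k0 b) n).

Lemma flipsS k0 b n : flips k0 b n.+1 = (flips k0 b n + flip k0 b n)%N.
Proof. by rewrite /flips mkseqS -cats1 count_cat /= addn0. Qed.

Lemma flips_le k0 b n : (flips k0 b n <= n)%N.
Proof. by rewrite -{2}(size_mkseq (flip k0 b) n) count_size. Qed.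

Lemma flips_mono k0 b m n : (m <= n)%N -> (flips k0 b m <= flips k0 b n)%N.
Proof.
by move=> /subnKC <-; elim: (n - m)%N => [|p IH];
  rewrite ?addn0// addnS flipsS (leq_trans IH)// leq_addr.
Qed.

Lemma nonflips_mono k0 b m n :
  (m <= n)%N -> (m - flips k0 b m <= n - flips k0 b n)%N.
Proof.
move=> /subnKC <-; elim: (n - m)%N => [|p IH]; rewrite ?addn0//.
apply: leq_trans IH _; rewrite addnS flipsS.
by have := flips_le k0 b (m + p); case: flip; lia.
Qed.

Lemma signU_direction (R : realType) k0 b n :
  signU R (direction k0 b n) = signU R k0 * (-1) ^+ flips k0 b n.
Proof.
elim: n => [|n IH]; first by rewrite /direction big_ord0 addr0 mulr1.
by rewrite directionS signU_turn odd_direction IH flipsS exprD mulrA.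
Qed.

Lemma signV_direction (R : realType) k0 b n :
  signV R (direction k0 b n) = signV R k0 * (-1) ^+ (n - flips k0 b n).
Proof.
elim: n => [|n IH]; first by rewrite /direction big_ord0 addr0 mulr1.
rewrite directionS signV_turn odd_direction IH flipsS -mulrA -exprD.
congr (_ * _ ^+ _); have := flips_le k0 b n; rewrite /flip.
by case: (_ == _) => /=; rewrite ?addn1 ?addn0 ?subSS// => h; rewrite subSn.
Qed.

(** * Thinning the events of the planar motion *)

Lemma measure_fin_partition (R : realType) (d : measure_display)
  (T : measurableType d) (mu : {measure set T -> \bar R}) (I : finType)
  (H : T -> I) (E : set T) :
  (forall i, measurable (E `&` H @^-1` [set i])) ->
  measurable E /\ mu E = (\sum_i mu (E `&` H @^-1` [set i]))%E.
Proof.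
move=> mE; have EE : E = \bigcup_(i in [set: I]) (E `&` H @^-1` [set i]).
  by apply/seteqP; split => [w Ew|w [i _ []]//]; exists (H w).
split; first by rewrite EE; apply: fin_bigcup_measurable.
have ET : [set: I] = [set` enum I].
  by apply/seteqP; split => i //= _; rewrite mem_enum.
rewrite [in LHS]EE measure_fin_bigcup//.
- by rewrite ET -(fsbig_seq _ _ (enum_uniq I)) -big_enum.
- exact: finite_finset.
- by move=> i j _ _ [w [[_ <-] [_ <-]]].
Qed.

(** The law of [v] with a fair random sign, as a function of the event. *)
Definition sign_law (R : realType) (v : R) (B : set R) : R :=
  (\1_B v + \1_B (- v)) / 2.

(** For a uniform direction the two signs are independent and fair. *)
Lemma sum_signs (R : realType) (B C : set R) :
  \sum_(k : 'Z_4) \1_B (signU R k / 2) * \1_C (signV R k / 2) =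
  4 * (sign_law (1 / 2) B * sign_law (1 / 2) C) :> R.
Proof.
have [a0 a1 a2 a3] := signU_val R; have [b0 b1 b2 b3] := signV_val R.
have -> : \sum_(k : 'Z_4) \1_B (signU R k / 2) * \1_C (signV R k / 2) =
    \sum_(k <- [:: Z4 0; Z4 1; Z4 2; Z4 3])
      \1_B (signU R k / 2) * \1_C (signV R k / 2) :> R.
  rewrite -big_enum; apply: perm_big; apply: uniq_perm => //.
    exact: enum_uniq.
  by move=> k; rewrite mem_enum; move: k; apply: Z4_case.
rewrite !big_cons big_nil a0 a1 a2 a3 b0 b1 b2 b3 /sign_law !mulNr.
by field.
Qed.

(** On the grid, U and V have been reversed [a k] and [b k] times, and their
    initial velocities lie in [B] and [C]. *)
Definition motion_skeleton (R : realType) (T : Type) (N : R -> T -> nat)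
    (K : T -> 'Z_4) (S : nat -> T -> bool) (n M : nat) (a b : nat -> nat)
    (B C : set R) : set T :=
  [set w | (forall k, (k <= M)%N ->
     let m := N (dyadic R n k) w in
     flips (K w) (S^~ w) m = a k /\ (m - flips (K w) (S^~ w) m)%N = b k) /\
     (B (signU R (K w) / 2) /\ C (signV R (K w) / 2))].

Lemma mkseq_tupleP (L : nat) (F : nat -> bool) :
  size (mkseq F L) == L.
Proof. by rewrite size_mkseq. Qed.

Lemma take_mkseq (A : Type) (F : nat -> A) (l L : nat) : (l <= L)%N ->
  take l (mkseq F L) = mkseq F l.
Proof.
by move=> lL; rewrite /mkseq -map_take take_iota (minn_idPl lL).
Qed.

Lemma prod_half_telescope (R : realType) (l : nat -> nat) M :
  counting_path M l ->
  \prod_(k < M) (2 ^+ (l k.+1 - l k))^-1 = (2 ^+ l M)^-1 :> R.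
Proof.
elim: M => [|M IH] lP; first by rewrite big_ord0 lP.1 expr0 invr1.
rewrite big_ord_recr/= IH; last exact: counting_pathW.
by rewrite -invfM -exprD subnKC// lP.2.
Qed.

Section motion.
Context (R : realType) (d : measure_display) (T : measurableType d)
  (P : probability T R) (rate : R -> R) (N : R -> {RV P >-> nat})
  (K : {RV P >-> 'Z_4}) (S : nat -> {RV P >-> bool}).
Hypothesis PN : poisson_process rate N.
Hypothesis rate_ge0 : forall t, 0 < t -> 0 <= rate t.
Hypothesis PK : forall k : 'Z_4, P (K @^-1` [set k]) = (1 / 4)%:E.
Hypothesis PS : forall j (b : bool), P (S j @^-1` [set b]) = (1 / 2)%:E.
Hypothesis indep : mutually_independent P (fun i : nat =>
          match i with
          | 0 => sigma_process (@nonneg_times R) N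
          | 1 => g_sigma_algebra_preimage K
          | j.+2 => g_sigma_algebra_preimage (S j)
          end).

Definition switch_event (E : set T) (k : 'Z_4) (s : nat -> bool) (L : nat) :=
  [set w | [/\ E w, K w = k & forall j, (j < L)%N -> S j w = s j]].

Lemma switch_eventP (n M : nat) (l : nat -> nat) (k : 'Z_4) (s : nat -> bool)
    (L : nat) : let E := skeleton N n M l in
  measurable (switch_event E k s L) /\
  P (switch_event E k s L) = (P E * (4^-1 / 2 ^+ L)%:E)%E.
Proof.
move=> E; pose A (i : nat) : set T := match i with
  | 0 => E | 1 => K @^-1` [set k] | j.+2 => S j @^-1` [set s j] end.
have AE : switch_event E k s L =
    \bigcap_(i in [set` [fset x in iota 0 L.+2]%fset]) A i.
  have memJ i : (i \in [fset x in iota 0 L.+2]%fset) = (i < L.+2)%N.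
    by rewrite in_fset mem_iota.
  apply/seteqP; split => w.
    move=> [Ew Kw Sw] i iJ; have {iJ} : (i < L.+2)%N by rewrite -memJ.
    by case: i => [|[|j]]// jL; exact: Sw.
  move=> Aw; split.
  - by apply: (Aw 0%N); rewrite /mkset memJ.
  - by apply: (Aw 1%N); rewrite /mkset memJ.
  - by move=> j jL; apply: (Aw j.+2); rewrite /mkset memJ.
have mA i : measurable (A i).
  case: i => [|[|j]]/=; first exact: measurable_skeleton.
    by rewrite -[X in measurable X]setTI; exact: measurable_funP.
  by rewrite -[X in measurable X]setTI; exact: measurable_funP.
split; first by rewrite AE; apply: bigcap_measurableType.
rewrite AE indep; last first.
  move=> [|[|j]] _ /=; first exact: sigma_process_skeleton.
  - by exists [set k] => //; rewrite setTI.
  - by exists [set s j] => //; rewrite setTI.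
rewrite prod_iota_fset !big_ord_recl/= PK.
under eq_bigr do rewrite PS.
rewrite prodEFin prodr_const card_ord -EFinM; congr (_ * _%:E)%E.
by rewrite !div1r exprVn.
Qed.

Definition flip_tuple (w : T) (L : nat) : L.-tuple bool :=
  Tuple (mkseq_tupleP L (flip (K w) (fun j => S j w))).

(** Once the initial direction and the first [L] reversal bits are known, the
    event only constrains the total number of switches; the coins themselves
    are recovered from the bits and the parity of the direction. *)
Lemma motion_skeleton_cell (n M : nat) (a b : nat -> nat) (B C : set R)
    (k : 'Z_4) (L : nat) (f : L.-tuple bool) :
  let l k := (a k + b k)%N in
  (forall k, (k <= M)%N -> (l k <= L)%N) ->
  motion_skeleton N K (fun j w => S j w) n M a b B C `&`
    (fun w => (K w, flip_tuple w L)) @^-1` [set (k, f)] =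
  if [&& f \in block_tuples l a M L, signU R k / 2 \in B &
      signV R k / 2 \in C]
  then switch_event (skeleton N n M l) k
         (fun j => nth false f j == odd k (+) odd j) L
  else set0.
Proof.
move=> l lL; case: ifPn => [/and3P[]|].
  rewrite inE => /forallP fB /set_mem kB /set_mem kC.
  apply/seteqP; split => w.
    move=> [[wP _] [Kw fw]]; split => //.
      move=> m mM; have [wa wb] := wP m mM.
      by rewrite /l -wa -wb subnKC// flips_le.
    move=> j jL; rewrite -fw /= nth_mkseq// /flip Kw.
    by case: (S j w); case: (odd k (+) odd j).
  move=> [Nw Kw Sw].
  have flipE j : (j < L)%N -> flip k (fun j => S j w) j = nth false f j.
    move=> jL; rewrite /flip Sw//.
    by case: (nth false f j); case: (odd k (+) odd j).
  have mkE : mkseq (flip k (fun j => S j w)) L = f.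
    apply: (@eq_from_nth _ false); rewrite size_mkseq ?size_tuple// => j jL.
    by rewrite nth_mkseq// flipE.
  have flE m : (m <= M)%N -> flips k (fun j => S j w) (l m) = a m.
    move=> mM; have /= /eqP := fB (Ordinal (mM : m < M.+1)%N).
    by rewrite -mkE take_mkseq ?lL.
  split; last first.
    by rewrite /preimage/= Kw; congr pair; apply: val_inj; rewrite /= Kw.
  split; last by rewrite Kw.
  by move=> m mM /=; rewrite Nw// Kw flE// /l addKn.
move=> /negP nP; apply/seteqP; split => w //.
move=> [[wP [wB wC]] [Kw fw]]; apply: nP; rewrite -Kw.
apply/and3P; split; [|exact: mem_set|exact: mem_set].
rewrite inE; apply/forallP => m.
have [wa wb] := wP m (ltn_ord m).
have lE : l m = N (dyadic R n m) w by rewrite /l -wa -wb subnKC// flips_le.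
have lm : (l m <= L)%N by apply: lL; rewrite -ltnS ltn_ord.
have -> : tval f = mkseq (flip (K w) (fun j => S j w)) L by rewrite -fw.
by rewrite take_mkseq// lE; apply/eqP.
Qed.

(** The product form is the independence of the reversal counts and initial
    signs of U and V, and each factor is the grid law of a telegraph process with
    half the rate. It is obtained by summing over the initial direction and over
    the reversal bits of the first [a M + b M] switches. *)
Lemma motion_skeletonP (n M : nat) (a b : nat -> nat) (B C : set R) :
  counting_path M a -> counting_path M b ->
  let E := motion_skeleton N K (fun j w => S j w) n M a b B C in
  let pw r (l : nat -> nat) (k : nat) :=
    poisson_weight (r / 2) (l k.+1 - l k) in
  measurable E /\
  P E = ((\prod_(k < M) pw (dyadic_intensity rate n k) a k * sign_law (1 / 2) B) *
         (\prod_(k < M) pw (dyadic_intensity rate n k) b k * sign_law (1 / 2) C))%:E.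
Proof.
move=> aP bP E pw; pose l k := (a k + b k)%N; pose L := l M.
have lP : counting_path M l by exact: counting_pathD.
have lL k : (k <= M)%N -> (l k <= L)%N by exact: leq_counting_path.
pose H w := (K w, flip_tuple w L).
have cellE p := motion_skeleton_cell n B C p.1 p.2 lL.
have cell p : measurable (E `&` H @^-1` [set p]) /\
    P (E `&` H @^-1` [set p]) = ((p.2 \in block_tuples l a M L)%:R *
      (\1_B (signU R p.1 / 2) * \1_C (signV R p.1 / 2)) *
      (\prod_(k < M) poisson_weight (dyadic_intensity rate n k) (l k.+1 - l k) *
        (4^-1 / 2 ^+ L)))%:E.
  rewrite [p]surjective_pairing cellE !indicE; case: ifPn.
    move=> /and3P[-> -> ->] /=; rewrite !mul1r.
    have [m ->] := switch_eventP n M l p.1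
      (fun j => nth false p.2 j == odd p.1 (+) odd j) L.
    by split => //; rewrite (poisson_skeleton _ PN).
  move=> h; rewrite measure0; split; first exact: measurable0.
  move: h; case: (_ \in block_tuples _ _ _ _); last by rewrite !mul0r.
  case: (_ \in B); last by rewrite mul0r mulr0 mul0r.
  by case: (_ \in C); rewrite // !mulr0 mul0r.
have [mE ->] := measure_fin_partition P (fun p => (cell p).1).
split => //; rewrite (eq_bigr _ (fun p _ => (cell p).2)).
rewrite sumEFin; congr EFin; rewrite -big_distrl/=.
rewrite -(pair_bigA _ (fun k (f : L.-tuple bool) =>
  (f \in block_tuples l a M L)%:R *
  (\1_B (signU R k / 2) * \1_C (signV R k / 2) : R)))/=.
under eq_bigr do rewrite -big_distrl/=.
rewrite -big_distrr/= sum_signs.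
have -> : \sum_(f : L.-tuple bool) (f \in block_tuples l a M L)%:R =
    \prod_(k < M) 'C(l k.+1 - l k, a k.+1 - a k)%:R :> R.
  rewrite -natr_prod -(card_block_tuples (L := L) erefl lP aP).
  rewrite -sum1_card natr_sum [RHS]big_mkcond/=.
  by apply: eq_bigr => f _; case: (_ \in _).
have -> : (2 ^+ L)^-1 = \prod_(k < M) (2 ^+ (l k.+1 - l k))^-1 :> R.
  by rewrite prod_half_telescope.
(* The powers of 2 and the binomial coefficients are distributed over the grid
   intervals, and thinning applies to each interval separately. *)
have core : \prod_(k < M) pw (dyadic_intensity rate n k) a k *
    \prod_(k < M) pw (dyadic_intensity rate n k) b k =
    \prod_(k < M) poisson_weight (dyadic_intensity rate n k) (l k.+1 - l k) *
    (\prod_(k < M) 'C(l k.+1 - l k, a k.+1 - a k)%:R *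
     \prod_(k < M) (2 ^+ (l k.+1 - l k))^-1) :> R.
  rewrite -!big_split/=; apply: eq_bigr => k _.
  have -> : (l k.+1 - l k = (a k.+1 - a k) + (b k.+1 - b k))%N.
    by have := aP.2 k (ltn_ord k); have := bP.2 k (ltn_ord k); rewrite /l; lia.
  by rewrite poisson_weight_thinning.
rewrite [RHS]mulrACA core.
by field.
Qed.

End motion.

(** * A telegraph process on a dyadic grid *)

(** The two atoms carry the whole mass, so [V] takes no other value almost
    surely. *)
Lemma sign_lawP (R : realType) (d : measure_display) (T : measurableType d)
  (P : probability T R) (v : R) (V : {RV P >-> R}) (B : set R) : 0 < v ->
  P (V @^-1` [set v]) = (1 / 2)%:E -> P (V @^-1` [set - v]) = (1 / 2)%:E ->
  measurable B -> P (V @^-1` B) = (sign_law v B)%:E.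
Proof.
move=> v0 Pv PNv mB.
have mV (C : set R) : measurable C -> measurable (V @^-1` C).
  by move=> mC; rewrite -[X in measurable X]setTI; exact: measurable_funP.
pose A := V @^-1` [set v] `|` V @^-1` [set - v].
have mA : measurable A by apply: measurableU; exact: mV.
have dis : V @^-1` [set v] `&` V @^-1` [set - v] = set0.
  apply/seteqP; split => w // [/= -> /eqP].
  by rewrite -addr_eq0 gt_eqF// addr_gt0.
have PU (C D : set T) : measurable C -> measurable D -> C `&` D = set0 ->
    P (C `|` D) = (P C + P D)%E by exact: measureU.
have PA : P A = 1%E.
  rewrite /A PU ?dis//.
  by rewrite Pv PNv -EFinD -splitr.
have PAC : P (~` A) = 0%E by rewrite probability_setC// PA subee.
have atom u : P (V @^-1` [set u]) = (1 / 2)%:E ->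
    P (V @^-1` B `&` V @^-1` [set u]) = (\1_B u / 2)%:E.
  move=> Pu; rewrite -preimage_setI indicE; case: (boolP (u \in B)) => uB.
    rewrite (_ : B `&` [set u] = [set u]) ?Pu//.
    by apply/setIidPr => _ ->; exact: set_mem.
  rewrite (_ : B `&` [set u] = set0) ?preimage_set0 ?measure0 ?mul0r//.
  by apply/seteqP; split => // w [Bw wu]; move: uB; rewrite -wu mem_set.
have null : P (V @^-1` B `\` A) = 0%E.
  apply/eqP; rewrite -measure_le0 -PAC le_measure ?inE//.
  - by apply: measurableD => //; exact: mV.
  - exact: measurableC.
have -> : P (V @^-1` B) = (P (V @^-1` B `\` A) + P (V @^-1` B `&` A))%E.
  by apply: measureDI => //; exact: mV.
rewrite null add0e /A setIUr PU.
- by rewrite !atom// -EFinD -mulrDl.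
- by apply: measurableI; exact: mV.
- by apply: measurableI; exact: mV.
- by rewrite setIACA dis setI0.
Qed.

Lemma dyadic_intensity_half (R : realType) (rate : R -> R) n k :
  lebesgue_measure.-integrable `]0, dyadic R n k.+1]
    (fun x : R => (rate x)%:E) ->
  dyadic_intensity (fun t => rate t / 2) n k = dyadic_intensity rate n k / 2.
Proof.
move=> ir; rewrite /dyadic_intensity RintegralZr//.
apply: integrableS ir; [exact: measurable_itv|exact: measurable_itv|].
by apply: subset_itvr; rewrite bnd_simp; exact: dyadic_ge0.
Qed.

Section telegraph.
Context (R : realType) (d : measure_display) (T : measurableType d)
  (P : probability T R) (rate : R -> R) (N : R -> {RV P >-> nat})
  (V0 : {RV P >-> R}) (v : R).
Hypothesis v_gt0 : 0 < v.
Hypothesis PN : poisson_process rate N.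
Hypothesis rate_ge0 : forall t, 0 < t -> 0 <= rate t.
Hypothesis V0_law : P (V0 @^-1` [set v]) = (1 / 2)%:E /\
        P (V0 @^-1` [set - v]) = (1 / 2)%:E.
Hypothesis indep : independent_pair P (sigma_process (@nonneg_times R) N)
          (g_sigma_algebra_preimage V0).

Lemma telegraph_skeletonP (n M : nat) (a : nat -> nat) (B : set R) :
  counting_path M a -> measurable B ->
  P (skeleton N n M a `&` V0 @^-1` B) =
  (\prod_(k < M) poisson_weight (dyadic_intensity rate n k) (a k.+1 - a k) *
   sign_law v B)%:E.
Proof.
move=> aP mB; have [Pv PNv] := V0_law.
rewrite indep; last 2 first.
- exact: sigma_process_skeleton.
- by exists B => //; rewrite setTI.
by rewrite (poisson_skeleton _ PN)// (sign_lawP v_gt0).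
Qed.

End telegraph.

(** * The space of pairs of signed counting paths *)

Section product_probability.
Context (R : realType) (d1 d2 : measure_display) (T1 : measurableType d1)
  (T2 : measurableType d2) (P : probability T1 R) (Q : probability T2 R).

Definition product_probability : set (T1 * T2) -> \bar R := (P \x Q)%E.

HB.instance Definition _ := Measure.on product_probability.

Let product_probability_setT : product_probability setT = 1%E.
Proof.
rewrite /product_probability -setXTT.
transitivity (P setT * Q setT)%E; first exact: product_measure1E.
by rewrite !probability_setT mule1.
Qed.

HB.instance Definition _ :=
  Measure_isProbability.Build _ _ R product_probability product_probability_setT.

End product_probability.

(** The reversal counts of U and V as functions of time, with the initial
    velocities of U and V. *)
Definition signed_counts (R : realType) : Type :=
  ((R -> nat * nat) * (R * R))%type.
HB.instance Definition _ (R : realType) := Pointed.on (signed_counts R).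

Section cylinders.
Context {R : realType}.
Local Notation Om := (signed_counts R).

Definition dyadic_cylinder (n : nat) (m : nat -> nat * nat) (B C : set R)
    : set Om :=
  [set x | (forall k, (k <= n * 2 ^ n)%N -> x.1 (dyadic R n k) = m k) /\
    (B x.2.1 /\ C x.2.2)].

Definition dyadic_cylinders : set_system Om :=
  [set A | exists n m B C, [/\ measurable B, measurable C &
    A = dyadic_cylinder n m B C]].

Lemma dyadic_level_le n p k :
  (k <= n * 2 ^ n)%N -> (k * 2 ^ p <= (n + p) * 2 ^ (n + p))%N.
Proof.
move=> kn; rewrite expnD mulnA leq_mul2r expn_eq0/=.
by rewrite (leq_trans kn)// leq_mul2r leq_addr orbT.
Qed.

(** The grid of level [n] is contained in that of level [n + p], so the finer
    cylinder either determines the coarser values consistently, or the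
    intersection is empty; the latter is a cylinder with [B] empty. *)
Lemma setI_dyadic_cylinders : setI_closed dyadic_cylinders.
Proof.
have main n p m m' B C B' C' :
    measurable B -> measurable C -> measurable B' -> measurable C' ->
    dyadic_cylinders (dyadic_cylinder n m B C `&`
      dyadic_cylinder (n + p) m' B' C').
  move=> mB mC mB' mC'.
  case: (pselect (forall k, (k <= n * 2 ^ n)%N -> m' (k * 2 ^ p)%N = m k)) => h.
    exists (n + p)%N, m', (B `&` B'), (C `&` C').
    split; [exact: measurableI|exact: measurableI|].
    apply/seteqP; split => x /=.
      by move=> [[_ [xB xC]] [xm [xB' xC']]].
    move=> [xm [[xB xB'] [xC xC']]]; split; split => // k kn.
    by rewrite -(dyadic_refine R n p k) xm ?dyadic_level_le// h.
  exists 0%N, m, set0, C; split => //.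
  apply/seteqP; split => x /=; last by move=> [_ []].
  move=> [[xm _] [xm' _]]; exfalso; apply: h => k kn.
  by rewrite -xm// -(dyadic_refine R n p k) xm' ?dyadic_level_le.
move=> _ _ [n [m [B [C [mB mC ->]]]]] [n' [m' [B' [C' [mB' mC' ->]]]]].
have [nn'|/ltnW nn'] := leqP n n'.
  by rewrite -(subnKC nn'); exact: main.
by rewrite -(subnKC nn') setIC; exact: main.
Qed.

Local Notation mOm := (g_sigma_algebraType dyadic_cylinders).

(** The cylinders prescribe all values at a grid level, so an event about one
    of them is the union of cylinders over the countably many value lists. *)
Lemma measurable_counts n k (Y : set (nat * nat)) :
  measurable ([set x | Y (x.1 (dyadic R n k))] : set mOm).
Proof.
(* Level n + k is fine and long enough to contain the point of index k of
   level n, at index k 2^k. *)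
pose F (m : seq (nat * nat)) : set mOm :=
  if nth (0, 0)%N m (k * 2 ^ k) \in Y then
    dyadic_cylinder (n + k) (nth (0, 0)%N m) setT setT else set0.
have kk : (k * 2 ^ k <= (n + k) * 2 ^ (n + k))%N.
  by rewrite leq_mul// ?leq_addl// leq_exp2l// leq_addl.
have -> : [set x | Y (x.1 (dyadic R n k))] = \bigcup_m F m.
  apply/seteqP; split => x /=.
    rewrite -(dyadic_refine R n k k) => Yx.
    exists (mkseq (fun j => x.1 (dyadic R (n + k) j))
      ((n + k) * 2 ^ (n + k)).+1) => //.
    rewrite /F nth_mkseq// mem_set//; split => // j jn.
    by rewrite nth_mkseq.
  move=> [m _]; rewrite /F; case: ifPn => [/set_mem Ym [xm _]|//].
  by rewrite -(dyadic_refine R n k k) xm.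
apply: countable_bigcupT_measurable => // m; rewrite /F; case: ifPn => // _.
apply: sub_sigma_algebra.
by exists (n + k)%N, (nth (0, 0)%N m), setT, setT.
Qed.

Lemma measurable_signs :
  measurable_fun setT (fun x : mOm => x.2.1 : R) /\
  measurable_fun setT (fun x : mOm => x.2.2 : R).
Proof.
split => _ B mB; rewrite setTI.
  have -> : (fun x : mOm => x.2.1) @^-1` B =
      \bigcup_c dyadic_cylinder 0 (fun=> c) B setT.
    apply/seteqP; split => x /=; last by move=> [c _ [_ []]].
    move=> Bx; exists (x.1 (dyadic R 0 0)) => //; split => // k.
    by rewrite mul0n leqn0 => /eqP ->.
  apply: countable_bigcupT_measurable => // c; apply: sub_sigma_algebra.
  by exists 0%N, (fun=> c), B, setT.
have -> : (fun x : mOm => x.2.2) @^-1` B =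
    \bigcup_c dyadic_cylinder 0 (fun=> c) setT B.
  apply/seteqP; split => x /=; last by move=> [c _ [_ []]].
  move=> Bx; exists (x.1 (dyadic R 0 0)) => //; split => // k.
  by rewrite mul0n leqn0 => /eqP ->.
apply: countable_bigcupT_measurable => // c; apply: sub_sigma_algebra.
by exists 0%N, (fun=> c), setT, B.
Qed.

End cylinders.

(** * Positions as functionals of signed counts *)

Lemma measurable_riemann_lim (R : realType) (d : measure_display)
  (S : measurableType d) (f : S -> R -> R) (t : R) :
  (forall n k, measurable_fun setT (fun x => f x (dyadic R n k))) ->
  measurable_fun setT (fun x => riemann_lim (f x) t).
Proof.
move=> mf; apply: measurableT_comp; first exact: fine_measurable.
apply: measurable_fun_limn_esup => n; apply/measurable_EFinP.
by apply: measurable_sum => k; exact: measurable_funM.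
Qed.

Definition velocity (R : realType) (v : R) (N : R -> nat) (s : R) : R :=
  v * (-1) ^+ N s.

Lemma normr_velocity (R : realType) v (N : R -> nat) s :
  `|velocity v N s| <= `|v|.
Proof. by rewrite /velocity normrM normrX normrN1 expr1n mulr1. Qed.

Lemma right_step_comp (R : realType) (E F : Type) (g : E -> F) (f : R -> E) :
  right_step f -> right_step (g \o f).
Proof.
by move=> rf s s0; have := rf s s0; apply: filterS => u /= ->.
Qed.

Definition pathU (R : realType) (x : signed_counts R) (t : R) : R :=
  riemann_lim (velocity x.2.1 (fun s => (x.1 s).1)) t.

Definition pathV (R : realType) (x : signed_counts R) (t : R) : R :=
  riemann_lim (velocity x.2.2 (fun s => (x.1 s).2)) t.

Lemma measurable_pathU (R : realType) t :
  measurable_fun setT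
    (fun x : g_sigma_algebraType (@dyadic_cylinders R) => pathU x t).
Proof.
apply: (measurable_riemann_lim (f := fun x : g_sigma_algebraType dyadic_cylinders =>
   velocity x.2.1 (fun s => (x.1 s).1))) => n k; apply: measurable_funM.
  exact: (measurable_signs (R := R)).1.
move=> _ B mB; rewrite setTI.
exact: (measurable_counts n k [set c | B ((-1) ^+ c.1)]).
Qed.

Lemma measurable_pathV (R : realType) t :
  measurable_fun setT
    (fun x : g_sigma_algebraType (@dyadic_cylinders R) => pathV x t).
Proof.
apply: (measurable_riemann_lim (f := fun x : g_sigma_algebraType dyadic_cylinders =>
   velocity x.2.2 (fun s => (x.1 s).2))) => n k; apply: measurable_funM.
  exact: (measurable_signs (R := R)).2.
move=> _ B mB; rewrite setTI.
exact: (measurable_counts n k [set c | B ((-1) ^+ c.2)]).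
Qed.

Lemma poisson_right_step (R : realType) (d : measure_display)
  (T : measurableType d) (P : probability T R) (rate : R -> R)
  (N : R -> {RV P >-> nat}) w :
  poisson_process rate N -> right_step (fun t => N t w).
Proof.
by move=> [_ Npath _ _] s s0; have [_ _ /(_ s s0)] := Npath w;
  apply: filterS => u ->.
Qed.

Section motion_counts.
Context (R : realType) (d : measure_display) (T : measurableType d)
  (P : probability T R) (rate : R -> R) (N : R -> {RV P >-> nat})
  (K : {RV P >-> 'Z_4}) (S : nat -> {RV P >-> bool}).

Definition motion_counts (w : T) : signed_counts R :=
  ((fun t => let m := flips (K w) (fun j => S j w) (N t w) in
     (m, (N t w - m)%N)),
   (signU R (K w) / 2, signV R (K w) / 2)).

Lemma motion_counts_cylinder n (m : nat -> nat * nat) (B C : set R) :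
  motion_counts @^-1` dyadic_cylinder n m B C =
  motion_skeleton N K (fun j w => S j w) n (n * 2 ^ n)
    (fun k => (m k).1) (fun k => (m k).2) B C.
Proof.
apply/seteqP; split => w [wm wBC]; split=> // k kn.
  by have := wm k kn; case: (m k) => a b /= [<- <-].
by have [/= wa wb] := wm k kn; case: (m k) wa wb => a b /= <- <-.
Qed.

Hypothesis PN : poisson_process rate N.

(** Rotating back: [speed_dirX] and [speed_dirY] express the velocity of the
    particle through the two signs, which by [signU_direction] and
    [signV_direction] are those of the reversal counts. *)
Lemma motion_pathE (cX cY t : R) (w : T) :
  let D s := direction (K w) (fun j => S j w) (N s w) in
  \int[lebesgue_measure]_(s in `[0, t]) (speed cX cY (D s) * dirX (D s)) =
    cX * (pathU (motion_counts w) t + pathV (motion_counts w) t) /\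
  \int[lebesgue_measure]_(s in `[0, t]) (speed cX cY (D s) * dirY (D s)) =
    cY * (pathU (motion_counts w) t - pathV (motion_counts w) t).
Proof.
move=> D; have rN := poisson_right_step w PN.
pose zA s := flips (K w) (fun j => S j w) (N s w).
pose zB s := (N s w - zA s)%N.
have [iA EA] := integral_right_step t
  (right_step_comp (fun m => signU R (K w) / 2 * (-1) ^+
     flips (K w) (fun j => S j w) m) rN)
  (fun s => normr_velocity (signU R (K w) / 2) zA s).
have [iB EB] := integral_right_step t
  (right_step_comp (fun m => signV R (K w) / 2 * (-1) ^+
     (m - flips (K w) (fun j => S j w) m)%N) rN)
  (fun s => normr_velocity (signV R (K w) / 2) zB s).
have -> : pathU (motion_counts w) t =
    \int[lebesgue_measure]_(s in `[0, t]) (signU R (D s) / 2).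
  rewrite /pathU -EA; apply: eq_Rintegral => s _ /=.
  by rewrite signU_direction mulrAC.
have -> : pathV (motion_counts w) t =
    \int[lebesgue_measure]_(s in `[0, t]) (signV R (D s) / 2).
  rewrite /pathV -EB; apply: eq_Rintegral => s _ /=.
  by rewrite signV_direction mulrAC.
have {}iA : lebesgue_measure.-integrable `[0%R, t]
    (EFin \o (fun s => signU R (D s) / 2)).
  by apply: eq_integrable iA => // s _ /=; rewrite signU_direction mulrAC.
have {}iB : lebesgue_measure.-integrable `[0%R, t]
    (EFin \o (fun s => signV R (D s) / 2)).
  by apply: eq_integrable iB => // s _ /=; rewrite signV_direction mulrAC.
have iD : lebesgue_measure.-integrable `[0%R, t]
  (EFin \o (fun s => signU R (D s) / 2 + signV R (D s) / 2)).
  by apply: (integrableD _ iA iB); exact: measurable_itv.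
have iS : lebesgue_measure.-integrable `[0%R, t]
  (EFin \o (fun s => signU R (D s) / 2 - signV R (D s) / 2)).
  by apply: (integrableB _ iA iB); exact: measurable_itv.
split.
  rewrite -(RintegralD _ iA iB); last exact: measurable_itv.
  rewrite -(RintegralZl _ _ iD); last exact: measurable_itv.
  by apply: eq_Rintegral => s _; rewrite speed_dirX mulrDl.
rewrite -(RintegralB _ iA iB); last exact: measurable_itv.
rewrite -(RintegralZl _ _ iS); last exact: measurable_itv.
by apply: eq_Rintegral => s _; rewrite speed_dirY mulrBl.
Qed.

End motion_counts.

(** * Equality of the laws *)

Section poisson_counting_path.
Context (R : realType) (d : measure_display) (T : measurableType d)
  (P : probability T R) (rate : R -> R) (N : R -> {RV P >-> nat}).
Hypothesis PN : poisson_process rate N.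

Lemma poisson_counting_path n M w :
  counting_path M (fun k => N (dyadic R n k) w).
Proof.
have [_ /(_ w)[N0 mono _] _ _] := PN; split; first by rewrite dyadic0.
by move=> k _; apply: mono; [exact: dyadic_ge0|exact: dyadic_le].
Qed.

Lemma skeleton_counting_path n M l w :
  skeleton N n M l w -> counting_path M l.
Proof.
by move=> h; apply: eq_counting_path (poisson_counting_path n M w) => k /h.
Qed.

Lemma motion_skeleton_counting_path K S n M a b B C w :
  motion_skeleton N K S n M a b B C w -> counting_path M a /\ counting_path M b.
Proof.
move=> [h _]; have [N0 NM] := poisson_counting_path n M w.
split.
  apply: eq_counting_path (fun k kM => esym (h k kM).1) _.
  by split=> [|k kM]; rewrite /= ?N0//; apply: flips_mono; exact: NM.
apply: eq_counting_path (fun k kM => esym (h k kM).2) _.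
by split=> [|k kM]; rewrite /= ?N0//; apply: nonflips_mono; exact: NM.
Qed.

End poisson_counting_path.

Definition paths_sigma (R : realType) : set_system (R -> R) :=
  sigma_process (@nonneg_times R) (fun t (x : R -> R) => x t).

Section telegraph_paths.
Context (R : realType) (d : measure_display) (T : measurableType d)
  (P : probability T R).

(** The right-hand side depends only on the initial velocity and on the counts
    at dyadic times, whence the measurability. *)
Lemma telegraph_path_event (rate : R -> R) (M : R -> {RV P >-> nat})
    (W0 : {RV P >-> R}) (W : R -> T -> R) :
  poisson_process rate M ->
  (forall (t : R) (w : T), 0 <= t ->
    W t w = \int[lebesgue_measure]_(s in `[0, t]) (W0 w * (-1) ^+ M s w)) ->
  forall C : set (R -> R), paths_sigma C ->
  [set w | C (W ^~ w)] =
    [set w | C (fun t => riemann_lim (velocity (W0 w) (fun s => M s w)) t)] /\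
  measurable [set w | C (W ^~ w)].
Proof.
move=> PM WE C sC.
have e : [set w | C (W ^~ w)] =
    [set w | C (fun t => riemann_lim (velocity (W0 w) (fun s => M s w)) t)].
  apply/funext => w; apply: (sigma_process_eq sC) => t t0.
  rewrite WE//; have rM := poisson_right_step w PM.
  exact: (integral_right_step t (right_step_comp
    (fun m => W0 w * (-1) ^+ m) rM) (fun s => normr_velocity _ _ s)).2.
split => //; rewrite e.
apply: (sigma_process_preimage (phi := fun w t =>
  riemann_lim (velocity (W0 w) (fun s => M s w)) t) _ sC) => t _.
apply: (measurable_riemann_lim (f := fun w =>
  velocity (W0 w) (fun s => M s w))) => n k; apply: measurable_funM.
  exact: measurable_funP.
exact: (measurableT_comp (f := fun m : nat => (-1) ^+ m : R)).
Qed.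

Lemma sigma_process_path (W : R -> T -> R) (C : set (R -> R)) :
  paths_sigma C ->
  sigma_process (@nonneg_times R) W [set w | C (W ^~ w)].
Proof.
move=> sC.
pose G := \bigcup_(t in @nonneg_times R) g_sigma_algebra_preimage (W t).
apply: (sigma_process_preimage (S := g_sigma_algebraType G)
  (phi := fun w t => W t w) _ sC) => t t0 _ B mB.
by apply: sub_sigma_algebra; exists t => //; exists B.
Qed.

End telegraph_paths.

Section planar_paths.
Context (R : realType).

(** Events for which the law of a pair of independent processes is known from
    the laws of the two components. *)
Definition path_rectangles : set_system (R -> R * R) :=
  [set A | exists C C', [/\ paths_sigma C, paths_sigma C' &
    A = [set x | C (fun t => (x t).1) /\ C' (fun t => (x t).2)]]].

Lemma setI_path_rectangles : setI_closed path_rectangles.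
Proof.
have sI (C D : set (R -> R)) : paths_sigma C -> paths_sigma D ->
    paths_sigma (C `&` D).
  pose G := \bigcup_(t in @nonneg_times R)
    g_sigma_algebra_preimage (fun x : R -> R => x t).
  exact: (@measurableI _ (g_sigma_algebraType G)).
move=> _ _ [C [C' [sC sC' ->]]] [D [D' [sD sD' ->]]].
exists (C `&` D), (C' `&` D'); split; [exact: sI|exact: sI|].
by apply/seteqP; split => x /=; tauto.
Qed.

Lemma sigma_rotated_paths (cX cY : R) (A : set (R -> R * R)) : 
  sigma_process (@nonneg_times R) (fun t (x : R -> R * R) => x t) A ->
  <<s path_rectangles >>
    [set x | A (fun t => (cX * ((x t).1 + (x t).2), cY * ((x t).1 - (x t).2)))].
Proof.
move=> sA.
have coord t (B : set R) : 0 <= t -> measurable B ->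
    paths_sigma [set x | B (x t)].
  move=> t0 mB; apply: sub_sigma_algebra; exists t => //.
  by exists B => //; rewrite setTI.
have full : paths_sigma [set: R -> R].
  pose G := \bigcup_(t in @nonneg_times R)
    g_sigma_algebra_preimage (fun x : R -> R => x t).
  exact: (@measurableT _ (g_sigma_algebraType G)).
have m1 t : 0 <= t -> measurable_fun setT
    (fun x : g_sigma_algebraType path_rectangles => (x t).1).
  move=> t0 _ B mB; rewrite setTI; apply: sub_sigma_algebra.
  exists [set x | B (x t)], setT; split => //; first exact: coord.
  by apply/seteqP; split => x //= [].
have m2 t : 0 <= t -> measurable_fun setT
    (fun x : g_sigma_algebraType path_rectangles => (x t).2).
  move=> t0 _ B mB; rewrite setTI; apply: sub_sigma_algebra.
  exists setT, [set x | B (x t)]; split => //; first exact: coord.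
  by apply/seteqP; split => x //= [].
apply: (sigma_process_preimage (S := g_sigma_algebraType path_rectangles)
  (phi := fun x t => (cX * ((x t).1 + (x t).2), cY * ((x t).1 - (x t).2)))
  _ sA) => t t0.
apply: measurable_fun_pair; apply: measurable_funM => //.
  by apply: measurable_funD; [exact: m1|exact: m2].
by apply: measurable_funB; [exact: m1|exact: m2].
Qed.

End planar_paths.

Section representation.
Context (R : realType) (lambda : R -> R)
  (d1 : measure_display) (T1 : measurableType d1) (P1 : probability T1 R)
  (d2 : measure_display) (T2 : measurableType d2) (P2 : probability T2 R)
  (N : R -> {RV P1 >-> nat}) (K : {RV P1 >-> 'Z_4})
  (S : nat -> {RV P1 >-> bool})
  (NU NV : R -> {RV P2 >-> nat}) (U0 V0 : {RV P2 >-> R}).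
Hypothesis lambda_ge0 : forall t, 0 < t -> 0 <= lambda t.
Hypothesis PN : poisson_process lambda N.
Hypothesis PK : forall k : 'Z_4, P1 (K @^-1` [set k]) = (1 / 4)%:E.
Hypothesis PS : forall j (b : bool), P1 (S j @^-1` [set b]) = (1 / 2)%:E.
Hypothesis indepNKS : mutually_independent P1 (fun i : nat =>
          match i with
          | 0 => sigma_process (@nonneg_times R) N
          | 1 => g_sigma_algebra_preimage K
          | j.+2 => g_sigma_algebra_preimage (S j)
          end).
Hypothesis PNU : poisson_process (fun t => lambda t / 2) NU.
Hypothesis PNV : poisson_process (fun t => lambda t / 2) NV.
Hypothesis U0_law : P2 (U0 @^-1` [set 1 / 2]) = (1 / 2)%:E /\
        P2 (U0 @^-1` [set - (1 / 2)]) = (1 / 2)%:E.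
Hypothesis V0_law : P2 (V0 @^-1` [set 1 / 2]) = (1 / 2)%:E /\
        P2 (V0 @^-1` [set - (1 / 2)]) = (1 / 2)%:E.
Hypothesis indepU : independent_pair P2 (sigma_process (@nonneg_times R) NU)
          (g_sigma_algebra_preimage U0).
Hypothesis indepV : independent_pair P2 (sigma_process (@nonneg_times R) NV)
          (g_sigma_algebra_preimage V0).

(** The two telegraph processes are read off independent copies of the second
    space: there the two counting processes and the two initial velocities are
    mutually independent. *)
Definition pair_counts (w : T2 * T2) : signed_counts R :=
  ((fun t => (NU t w.1, NV t w.2)), (U0 w.1, V0 w.2)).

Let half_gt0 : 0 < 1 / 2 :> R. Proof. by rewrite divr_gt0. Qed.

Let half_rate_ge0 t : 0 < t -> 0 <= lambda t / 2.
Proof. by move=> /lambda_ge0 h; rewrite divr_ge0. Qed.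

Let mean_half n k : dyadic_intensity (fun t => lambda t / 2) n k =
  dyadic_intensity lambda n k / 2.
Proof.
by apply: dyadic_intensity_half; have [h _ _ _] := PN; apply: h; exact: dyadic_ge0.
Qed.

Lemma joint_counts_law A : <<s @dyadic_cylinders R >> A ->
  [/\ measurable (motion_counts N K S @^-1` A),
      measurable (pair_counts @^-1` A) &
      P1 (motion_counts N K S @^-1` A) =
      product_probability P2 P2 (pair_counts @^-1` A)].
Proof.
apply: pi_system_law_eq; first exact: setI_dyadic_cylinders.
move=> _ [n [m [B [C [mB mC ->]]]]].
pose M := (n * 2 ^ n)%N.
pose EU := skeleton NU n M (fun k => (m k).1) `&` U0 @^-1` B.
pose EV := skeleton NV n M (fun k => (m k).2) `&` V0 @^-1` C.
have E2 : pair_counts @^-1` dyadic_cylinder n m B C = EU `*` EV.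
  apply/seteqP; split => -[w w'] /=.
    move=> [wm [wB wC]]; split; split => // k kn.
      by have := wm k kn; case: (m k) => a b /= [->].
    by have := wm k kn; case: (m k) => a b /= [_ ->].
  move=> [[wa wB] [wb wC]]; split => // k kn.
  by rewrite /= (wa k kn) (wb k kn); case: (m k).
have mEU : measurable EU.
  apply: measurableI; first exact: measurable_skeleton.
  by rewrite -[X in measurable X]setTI; exact: measurable_funP.
have mEV : measurable EV.
  apply: measurableI; first exact: measurable_skeleton.
  by rewrite -[X in measurable X]setTI; exact: measurable_funP.
rewrite E2 motion_counts_cylinder.
have PE2 : product_probability P2 P2 (EU `*` EV) = (P2 EU * P2 EV)%E.
  exact: product_measure1E.
have mE2 : measurable (EU `*` EV) by exact: measurableX.
case: (pselect (counting_path M (fun k => (m k).1) /\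
  counting_path M (fun k => (m k).2))) => [[aP bP]|nm].
  have [mE1 PE1] :=
    motion_skeletonP PN lambda_ge0 PK PS indepNKS n B C aP bP.
  split => //; rewrite [RHS]PE2 PE1 EFinM; congr (_ * _)%E.
    rewrite (telegraph_skeletonP half_gt0 PNU half_rate_ge0 U0_law indepU)//.
    by congr (_ * _)%:E; apply: eq_bigr => k _; rewrite mean_half.
  rewrite (telegraph_skeletonP half_gt0 PNV half_rate_ge0 V0_law indepV)//.
  by congr (_ * _)%:E; apply: eq_bigr => k _; rewrite mean_half.
(* Counting processes start at 0 and do not decrease, so prescribed values that
   violate this describe the empty event on both sides. *)
have E10 : motion_skeleton N K (fun j w => S j w) n M
    (fun k => (m k).1) (fun k => (m k).2) B C = set0.
  apply/seteqP; split => w // /(motion_skeleton_counting_path PN).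
  exact: nm.
rewrite E10; split => //; rewrite [RHS]PE2 measure0.
apply/esym/eqP; rewrite mule_eq0.
have [aM|na] := pselect (counting_path M (fun k => (m k).1)).
  rewrite (_ : EV = set0) ?measure0 ?eqxx ?orbT//.
  apply/seteqP; split => w // [/(skeleton_counting_path PNV) bM _].
  by apply: nm; split.
rewrite (_ : EU = set0) ?measure0 ?eqxx//.
by apply/seteqP; split => w // [/(skeleton_counting_path PNU) aM _].
Qed.

Context (U V : R -> T2 -> R).
Hypothesis UE : forall (t : R) (w : T2), 0 <= t ->
  U t w = \int[lebesgue_measure]_(s in `[0, t]) (U0 w * (-1) ^+ NU s w).
Hypothesis VE : forall (t : R) (w : T2), 0 <= t ->
  V t w = \int[lebesgue_measure]_(s in `[0, t]) (V0 w * (-1) ^+ NV s w).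
Hypothesis indepUV : independent_pair P2
  (sigma_process (@nonneg_times R) U) (sigma_process (@nonneg_times R) V).

(** Independence of the two positions on the original space enters only here;
    on the product space it holds by construction. *)
Lemma rectangle_law (C C' : set (R -> R)) : paths_sigma C -> paths_sigma C' ->
  let E1 := [set w | C (pathU (motion_counts N K S w)) /\
                     C' (pathV (motion_counts N K S w))] in
  let E2 := [set w | C (U ^~ w) /\ C' (V ^~ w)] in
  [/\ measurable E1, measurable E2 & P1 E1 = P2 E2].
Proof.
move=> sC sC' E1 E2.
pose A := [set x : signed_counts R | C (pathU x) /\ C' (pathV x)].
have sA : <<s @dyadic_cylinders R >> A.
  suff : measurable (A : set (g_sigma_algebraType (@dyadic_cylinders R))).
    by [].
  apply: measurableI.
    by apply: (sigma_process_preimage _ sC) => t _; exact: measurable_pathU.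
  by apply: (sigma_process_preimage _ sC') => t _; exact: measurable_pathV.
have [EU mU] := telegraph_path_event PNU UE sC.
have [EV mV] := telegraph_path_event PNV VE sC'.
have [mE1 _ PE1] := joint_counts_law sA.
have AE : pair_counts @^-1` A = [set w | C (U ^~ w)] `*` [set w | C' (V ^~ w)].
  by rewrite EU EV; apply/seteqP; split => -[w w'].
split; [exact: mE1|exact: measurableI|].
rewrite [LHS]PE1 AE.
transitivity (P2 [set w | C (U ^~ w)] * P2 [set w | C' (V ^~ w)])%E.
  exact: product_measure1E.
by apply/esym/indepUV; exact: sigma_process_path.
Qed.

Lemma paths_law A : <<s @path_rectangles R >> A ->
  P1 [set w | A (fun t => (pathU (motion_counts N K S w) t,
                           pathV (motion_counts N K S w) t))] =
  P2 [set w | A (fun t => (U t w, V t w))].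
Proof.
move=> sA.
have [] // := pi_system_law_eq (P1 := P1) (P2 := P2)
  (Z1 := fun w t => (pathU (motion_counts N K S w) t,
                     pathV (motion_counts N K S w) t))
  (Z2 := fun w t => (U t w, V t w)) (@setI_path_rectangles R) _ sA.
by move=> _ [C [C' [sC sC' ->]]]; exact: rectangle_law.
Qed.

End representation.

Theorem mainTheorem6 (R : realType) (cX cY : R) (lambda : R -> R)
  (d1 : measure_display) (T1 : measurableType d1) (P1 : probability T1 R)
  (X Y : R -> T1 -> R)
  (d2 : measure_display) (T2 : measurableType d2) (P2 : probability T2 R)
  (U V : R -> T2 -> R)
  (cX_gt0 : 0 < cX) (cY_gt0 : 0 < cY)
  (lambda_C2 : C2_on [set t : R | 0 < t] lambda)
  (lambda_ge0 : forall t : R, 0 < t -> 0 <= lambda t)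
  (XY_motion : orthogonal_motion P1 cX cY lambda X Y)
  (U_telegraph : telegraph_process P2 (1 / 2) (fun t => lambda t / 2) U)
  (V_telegraph : telegraph_process P2 (1 / 2) (fun t => lambda t / 2) V)
  (UV_independent : independent_pair P2
     (sigma_process (@nonneg_times R) U) (sigma_process (@nonneg_times R) V)) :
  same_law P1 (fun t w => (X t w, Y t w))
           P2 (fun t w => (cX * (U t w + V t w), cY * (U t w - V t w))).
Proof.
case: XY_motion => N [K [S [PN PK PS indepNKS XYE]]].
case: U_telegraph => NU [U0 [PNU U0_law indepU UE]].
case: V_telegraph => NV [V0 [PNV V0_law indepV VE]].
move=> A sA.
have := paths_law lambda_ge0 PN PK PS indepNKS PNU PNV U0_law V0_law
  indepU indepV UE VE UV_independent (sigma_rotated_paths cX cY sA).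
rewrite /= => <-; congr (P1 _); apply/funext => w.
apply: (sigma_process_eq sA) => t t0.
have [-> ->] := XYE t w t0.
by have [-> ->] := motion_pathE K S PN cX cY t w.
Qed.
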